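(* Let $k\geqslant 2$ be an integer, let $\mathcal{A}=(a_i)_{i=1}^\infty$ be a non-decreasing sequence of positive integers such that $\gcd(a_1,a_2,\ldots,a_k)=1$, and let $D=\operatorname{lcm}(a_1,a_2,\ldots,a_k)$. For all integers $a,b>\frac{2\prod_{i=1}^k(1+iDk)}{k}+2$ we have $$p_{\mathcal{A}}(a,k)\,p_{\mathcal{A}}(b,k)>p_{\mathcal{A}}(a+b,k).$$
   Context: For a non-decreasing sequence $\mathcal{A}=(a_i)_{i=1}^\infty$ of positive integers, a positive integer $k$ and an integer $n\geqslant 0$, $p_{\mathcal{A}}(n,k)$ (the multicolor restricted partition function) denotes the number of partitions of $n$ with parts in the multiset $\{a_1,\ldots,a_k\}$, where equal entries $a_i=a_j$ with $i\neq j$ are regarded as distinct (differently colored) parts and the order of parts is irrelevant; equivalently $\sum_{n\geqslant 0}p_{\mathcal{A}}(n,k)x^n=\prod_{i=1}^k\frac{1}{1-x^{a_i}}$. *)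

(* Defs.v *)
From mathcomp Require Import all_boot all_order all_algebra.
Set Implicit Arguments.
Unset Strict Implicit.
Unset Printing Implicit Defensive.

(* Sequences are indexed from 0: [A i] stands for a_(i+1).                    *)
(* A partition of n into the coloured parts A 0, ..., A k.-1 is given by the  *)
(* multiplicity of each index, so that equal entries at distinct indices are  *)
(* distinct colours.  When the parts are positive, every multiplicity is at   *)
(* most n, whence the codomain 'I_n.+1.                                       *)
Definition multicolor_partitions (A : nat -> nat) (n k : nat) :
    {set {ffun 'I_k -> 'I_n.+1}} :=
  [set m : {ffun 'I_k -> 'I_n.+1} | \sum_(i < k) m i * A i == n].

Definition pA (A : nat -> nat) (n k : nat) : nat :=
  #|multicolor_partitions A n k|.

Definition gcd_upto (A : nat -> nat) (k : nat) : nat :=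
  \big[gcdn/0]_(i < k) A i.

Definition lcm_upto (A : nat -> nat) (k : nat) : nat :=
  \big[lcmn/1]_(i < k) A i.

(* Threshold for the Bessenrodt-Ono type inequality; k need not divide the    *)
(* numerator, so the quotient is taken in rat rather than with %/.            *)
Definition bo_bound (k D : nat) : rat :=
  ((2 * \prod_(1 <= i < k.+1) (1 + i * D * k))%N%:R / k%:R + 2%:R)%R.

(* Main.v *)
Require Import Defs.
From mathcomp Require Import all_boot all_order all_algebra.
From mathcomp Require Import zify.
Import Order.TTheory GRing.Theory Num.Theory.
Set Implicit Arguments.
Unset Strict Implicit.
Unset Printing Implicit Defensive.

(** Write k = L + 1 and let D be a common multiple of the parts a_0, ..., a_L.
    Dividing each multiplicity by w_i = D / a_i, m_i = q_i w_i + r_i, turns a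
    partition of n into a vector of residues r together with a composition q,
    since then n = D (q_0 + ... + q_L) + (r_0 a_0 + ... + r_L a_L).  So r has
    weight s(r) = r_0 a_0 + ... + r_L a_L congruent to n modulo D, and once r is
    given, q is any composition of (n - s(r)) / D into k nonnegative terms.
    Stars and bars give, for n >= kD, the exact formula [pA_residues]

      p(n) = sum over r of C(L + (n - s(r)) / D, L).

    As 0 <= s(r) < kD, each binomial lies between C(N, L) and C(N + L, L),
    where N is the integer part of n / D.  With M_n the number of admissible
    residue vectors,

      M_n C(N, L) <= p(n) <= M_n C(N + L, L).

    The numbers M_n need not be computed: subtracting a fixed r0 admissible for
    b, coordinatewise modulo w_i, injects the vectors admissible for a + b into
    those admissible for a, so M_(a+b) <= M_a <= M_a M_b as soon as M_b > 0, and
    M_b > 0 is Bezout's identity for parts of gcd 1.  With x and y the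
    integer parts of a / D and b / D, that of (a + b) / D is at most x + y + 1,
    and it only remains to see that

      C(x + y + L + 1, L) < C(x, L) C(y, L)  for L >= 1 and x, y > 3L,

    which is [leq_bin2l_mul].  The assumed lower bound on a and b ensures
    x, y > 3L, by [lt_bo_bound]. *)

(** * Binomial coefficients and compositions *)

(** Multiplied by (L!)^2, both sides are products over j < L, and factor by
    factor the claim is (L - j) (x + y + c - j) < (x - j) (y - j).  Passing to the next factor
    replaces (L, x, y, c) by (L - 1, x - 1, y - 1, c + 1); the hypotheses
    c + 2L <= x, y are chosen because they survive this change. *)
Lemma leq_bin2l_mul L x y c :
  3 * L < x -> 3 * L < y -> c + 2 * L <= x -> c + 2 * L <= y ->
  'C(x + y + c, L) <= 'C(x, L) * 'C(y, L) ?= iff (L == 0).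
Proof.
elim: L x y c => [|L IH] x y c hx hy hcx hcy; first by rewrite !bin0; split.
case: x hx hcx => // x hx hcx; case: y hy hcy => // y hy hcy.
have [le_bin _] : 'C(x + y + c.+1, L) <= 'C(x, L) * 'C(y, L) ?= iff (L == 0).
  by apply: IH; lia.
suff lt_bin : 'C(x.+1 + y.+1 + c, L.+1) < 'C(x.+1, L.+1) * 'C(y.+1, L.+1).
  by split; [exact: ltnW | rewrite ltn_eqF].
(* The absorption identity n C(n-1, L) = (L+1) C(n, L+1) on each binomial
   reduces the claim to the induction hypothesis and this inequality. *)
have lt_step : L.+1 * (x + y + c.+1).+1 < x.+1 * y.+1 by nia.
have shifted_gt0 : 0 < 'C(x + y + c.+1, L) by rewrite bin_gt0; lia.
have -> : x.+1 + y.+1 + c = (x + y + c.+1).+1 by lia.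
have ex := mul_bin_diag x.+1 L; have ey := mul_bin_diag y.+1 L.
have es := mul_bin_diag (x + y + c.+1).+1 L; rewrite /= in ex ey es.
rewrite -(ltn_pmul2l (ltn0Sn L)) -(ltn_pmul2l (ltn0Sn L)) -es.
rewrite [ltnRHS](_ : _ = (x.+1 * y.+1) * ('C(x, L) * 'C(y, L))); last first.
  by rewrite mulnACA ex ey mulnACA !mulnA.
rewrite mulnA; apply: leq_trans (leq_mul (leqnn _) le_bin).
by rewrite ltn_pmul2r.
Qed.

Lemma card_compositions L n :
  #|[set q : {ffun 'I_L.+1 -> 'I_n.+1} | \sum_i q i == n]| = 'C(L + n, L).
Proof.
pose tuple_of_ffun (q : {ffun 'I_L.+1 -> 'I_n.+1}) := [tuple q i | i < L.+1].
have bij_t : bijective tuple_of_ffun.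
  exists (fun t => [ffun i => tnth t i]) => [q|t].
    by apply/ffunP => i; rewrite ffunE tnth_mktuple.
  by apply: eq_from_tnth => i; rewrite tnth_mktuple ffunE.
rewrite -card_ord_partitions -(on_card_preimset (onW_bij _ bij_t)).
apply: eq_card => q; rewrite !inE big_tuple.
by under [in RHS]eq_bigr => i _ do rewrite tnth_mktuple.
Qed.

(** * Partitions by residues modulo D / a_i *)

Section Residues.

Variables (L D : nat) (A : nat -> nat).
Hypotheses (D_gt0 : 0 < D) (A_dvd : forall i : 'I_L.+1, A i %| D).

Let w (i : 'I_L.+1) := D %/ A i.

Let A_gt0 (i : 'I_L.+1) : 0 < A i.
Proof. exact: dvdn_gt0 (A_dvd i). Qed.

Let wA (i : 'I_L.+1) : w i * A i = D.
Proof. exact: divnK. Qed.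

Let w_gt0 (i : 'I_L.+1) : 0 < w i.
Proof. by rewrite divn_gt0 // dvdn_leq. Qed.

Let w_leD (i : 'I_L.+1) : w i <= D.
Proof. exact: leq_div. Qed.

Definition weight n (m : {ffun 'I_L.+1 -> 'I_n}) := \sum_(i < L.+1) m i * A i.

(** The i-th coordinates below w i = D / A i represent the integers modulo w i;
    the codomain 'I_D.+1 is only a common finite type containing all of them. *)
Definition residues n : {set {ffun 'I_L.+1 -> 'I_D.+1}} :=
  [set r : {ffun 'I_L.+1 -> 'I_D.+1} | [forall i, r i < w i] && (weight r == n %[mod D])].

Definition residue n (m : {ffun 'I_L.+1 -> 'I_n}) : {ffun 'I_L.+1 -> 'I_D.+1} :=
  [ffun i => inord (m i %% w i)].

Lemma residueE n (m : {ffun 'I_L.+1 -> 'I_n}) i :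
  residue m i = m i %% w i :> nat.
Proof.
by rewrite ffunE inordK // ltnS ltnW // (leq_trans _ (w_leD i)) // ltn_pmod.
Qed.

Lemma weight_divn_eq n (m : {ffun 'I_L.+1 -> 'I_n}) :
  weight m = (\sum_i m i %/ w i) * D + weight (residue m).
Proof.
rewrite big_distrl -big_split; apply: eq_bigr => i _ /=.
by rewrite residueE -[X in _ * X + _](wA i) mulnA -mulnDl -divn_eq.
Qed.

Lemma weight_residue n (m : {ffun 'I_L.+1 -> 'I_n}) :
  weight (residue m) = weight m %[mod D].
Proof. by rewrite [in RHS]weight_divn_eq modnMDl. Qed.

Lemma residue_in n (m : {ffun 'I_L.+1 -> 'I_n}) : residue m \in residues (weight m).
Proof.
rewrite inE weight_residue eqxx andbT.
by apply/forallP => i; rewrite residueE ltn_pmod.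
Qed.

(** Each of the L + 1 terms r_i a_i is below w_i a_i = D. *)
Lemma weight_lt n r : r \in residues n -> weight r < L.+1 * D.
Proof.
rewrite inE => /andP[/forallP ltr _].
have -> : L.+1 * D = \sum_(i < L.+1) D by rewrite sum_nat_const card_ord.
have lt_term (i : 'I_L.+1) : r i * A i < D by rewrite -[ltnRHS](wA i) ltn_pmul2r.
rewrite /weight !big_ord_recl /= -addSn leq_add ?lt_term //.
by apply: leq_sum => i _; apply: ltnW.
Qed.

(** The partitions with residue vector r are the q_i w_i + r_i for q a
    composition of N = (n - weight r) / D into L + 1 terms. *)
Lemma card_residue_class n r : r \in residues n -> weight r <= n ->
  #|[set m in multicolor_partitions A n L.+1 | residue m == r]|
    = 'C(L + (n - weight r) %/ D, L).
Proof.
rewrite inE => /andP[/forallP ltr /eqP r_n] le_r_n.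
set N := _ %/ D.
have ND : N * D + weight r = n.
  by rewrite divnK ?subnK // -eqn_mod_dvd // r_n.
pose lift_q (q : {ffun 'I_L.+1 -> 'I_N.+1}) : {ffun 'I_L.+1 -> 'I_n.+1} :=
  [ffun i => inord (q i * w i + r i)].
have sum_lift (q : {ffun 'I_L.+1 -> 'I_N.+1}) : \sum_i q i = N ->
    \sum_i (q i * w i + r i) * A i = n.
  move=> qN; rewrite -ND -[X in X * D]qN big_distrl -big_split; apply: eq_bigr => i _ /=.
  by rewrite mulnDl -mulnA wA.
have liftE (q : {ffun 'I_L.+1 -> 'I_N.+1}) i : \sum_i q i = N ->
    lift_q q i = q i * w i + r i :> nat.
  move=> qN; rewrite ffunE inordK // ltnS -[leqRHS](sum_lift q qN) (bigD1 i) //=.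
  by rewrite (leq_trans (leq_pmulr _ (A_gt0 i))) ?leq_addr.
rewrite -card_compositions.
have lift_inj : {in [set q : {ffun 'I_L.+1 -> 'I_N.+1} | \sum_i q i == N] &,
    injective lift_q}.
  move=> q q'; rewrite !inE => /eqP qN /eqP q'N eq_l; apply/ffunP => i.
  apply/val_inj/eqP; have := liftE q i qN.
  by rewrite eq_l liftE // => /eqP; rewrite eqn_add2r eqn_pmul2r // eq_sym.
rewrite -(card_in_imset lift_inj); apply: eq_card => m; apply/idP/imsetP.
  rewrite !inE => /andP[/eqP m_n /eqP m_r].
  have sumN : \sum_i m i %/ w i = N.
    apply/eqP; rewrite -(eqn_pmul2r D_gt0) -(eqn_add2r (weight r)) ND.
    by rewrite -m_r -weight_divn_eq; apply/eqP.
  pose q : {ffun 'I_L.+1 -> 'I_N.+1} := [ffun i => inord (m i %/ w i)].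
  have qE i : q i = m i %/ w i :> nat.
    by rewrite ffunE inordK // ltnS -[leqRHS]sumN (bigD1 i) //= leq_addr.
  have qN : \sum_i q i = N by rewrite -[RHS]sumN; apply: eq_bigr => i _; apply: qE.
  exists q; first by rewrite inE qN.
  by apply/ffunP => i; apply/val_inj; rewrite /= liftE // qE -m_r residueE -divn_eq.
case=> q; rewrite inE => /eqP qN ->; rewrite !inE; apply/andP; split.
  apply/eqP; rewrite -[RHS](sum_lift q qN).
  by apply: eq_bigr => i _; rewrite liftE.
apply/eqP/ffunP => i; apply/val_inj; rewrite /= residueE liftE //.
by rewrite modnMDl modn_small.
Qed.

Lemma pA_residues n : L.+1 * D <= n ->
  pA A n L.+1 = \sum_(r in residues n) 'C(L + (n - weight r) %/ D, L).
Proof.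
move=> le_n; rewrite /pA -sum1_card.
rewrite (partition_big (@residue n.+1) (mem (residues n))) /=; last first.
  by move=> m; rewrite inE => /eqP m_n; rewrite -[in residues n]m_n residue_in.
apply: eq_bigr => r r_n; rewrite sum1dep_card -card_residue_class //.
exact: leq_trans (ltnW (weight_lt r_n)) le_n.
Qed.

Lemma pA_le n : L.+1 * D <= n ->
  pA A n L.+1 <= #|residues n| * 'C(n %/ D + L, L).
Proof.
move=> le_n; rewrite pA_residues // -sum_nat_const; apply: leq_sum => r _.
by rewrite addnC leq_bin2l // leq_add2r leq_div2r ?leq_subr.
Qed.

(** Since weight r < (L + 1) D is congruent to n modulo D, subtracting it from n
    lowers the quotient by D by at most L. *)
Lemma pA_ge n : L.+1 * D <= n ->
  #|residues n| * 'C(n %/ D, L) <= pA A n L.+1.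
Proof.
move=> le_n; rewrite pA_residues // -sum_nat_const; apply: leq_sum => r r_n.
have lt_r := weight_lt r_n; move: r_n; rewrite inE => /andP[_ /eqP r_n].
have : weight r %/ D < L.+1 by rewrite ltn_divLR.
by move=> lt_q; rewrite leq_bin2l // divnB // r_n ltnn; lia.
Qed.

(** * Counting residue vectors *)

(** Subtracting s coordinatewise modulo w_i is injective and lowers the weight
    by b modulo D. *)
Lemma leq_card_residues a b :
  residues b != set0 -> #|residues (a + b)| <= #|residues a|.
Proof.
case/set0Pn => s; rewrite inE => /andP[/forallP lts /eqP s_b].
(* Adding w i - s i instead of subtracting s i avoids truncation; the sum is
   at most D + D, hence the intermediate codomain. *)
pose shift (r : {ffun 'I_L.+1 -> 'I_D.+1}) :=
  residue [ffun i => inord (r i + (w i - s i)) : 'I_(D + D).+1].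
have shiftE (r : {ffun 'I_L.+1 -> 'I_D.+1}) i :
    shift r i = (r i + (w i - s i)) %% w i :> nat.
  rewrite residueE ffunE inordK // ltnS leq_add ?leq_ord //.
  exact: leq_trans (leq_subr _ _) (w_leD i).
have shiftK (r : {ffun 'I_L.+1 -> 'I_D.+1}) i :
    shift r i + s i = r i %[mod w i].
  by rewrite shiftE modnDml -addnA subnK ?modnDr // ltnW.
rewrite -(card_in_imset (f := shift)); last first.
  move=> r r'; rewrite !inE => /andP[/forallP ltr _] /andP[/forallP ltr' _] eq_s.
  apply/ffunP => i; apply/val_inj => /=.
  by have := shiftK r i; rewrite eq_s shiftK !modn_small.
apply/subset_leq_card/subsetP => _ /imsetP[r r_in ->].
move: r_in; rewrite !inE => /andP[_ /eqP r_ab]; apply/andP; split.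
  by apply/forallP => i; rewrite shiftE ltn_pmod.
rewrite -(eqn_modDr b) -r_ab -modnDmr -s_b modnDmr -big_split /=.
apply/eqP; rewrite -modn_summ -[in RHS]modn_summ; congr (_ %% _).
apply: eq_bigr => i _; rewrite -mulnDl.
have modD x : x * A i %% D = x %% w i * A i by rewrite muln_modl wA.
by rewrite !modD shiftK.
Qed.

(** The integers congruent modulo D to a combination of the parts with
    nonnegative coefficients are stable under gcdn: working modulo D,
    the coefficient -1 in Bezout's identity can be replaced by D - 1. *)
Lemma bezout_gcd_upto : exists c : 'I_L.+1 -> nat,
  \sum_i c i * A i = gcd_upto A L.+1 %[mod D].
Proof.
rewrite /gcd_upto; elim/big_ind: _ => [|x y [c cx] [d dy]|i _].
- by exists (fun=> 0); rewrite big1.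
- case: (posnP x) cx => [-> _|x_gt0 cx]; first by rewrite gcd0n; exists d.
  have [u v uv _] := egcdnP y x_gt0.
  exists (fun i => u * c i + v * D.-1 * d i).
  have -> : \sum_i (u * c i + v * D.-1 * d i) * A i
      = u * (\sum_i c i * A i) + v * D.-1 * (\sum_i d i * A i).
    rewrite !big_distrr -big_split; apply: eq_bigr => i _ /=.
    by rewrite mulnDl !mulnA.
  rewrite -modnDm -modnMmr cx -[in X in _ + X]modnMmr dy !modnMmr modnDm uv.
  rewrite addnAC -mulnA -mulnDr -{1}[y]mul1n -mulnDl add1n prednK //.
  by rewrite mulnCA [D * _]mulnC modnMDl.
- exists (fun j => j == i); rewrite (bigD1 i) //= eqxx mul1n big1 ?addn0 //.
  by move=> j /negbTE ->.
Qed.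

(** Reduce the multiplicities n c_i modulo w_i, where c is a Bezout combination
    of weight 1 modulo D. *)
Lemma residues_neq0 n : gcd_upto A L.+1 = 1 -> residues n != set0.
Proof.
move=> gcd1; have [c] := bezout_gcd_upto; rewrite gcd1 => c1.
pose m : {ffun 'I_L.+1 -> 'I_(\sum_i n * c i).+1} := [ffun i => inord (n * c i)].
have mE i : m i = n * c i :> nat.
  by rewrite ffunE inordK // ltnS (bigD1 i) //= leq_addr.
apply/set0Pn; exists (residue m).
suff m_n : weight m = n %[mod D] by have := residue_in m; rewrite !inE m_n.
have -> : weight m = n * \sum_i c i * A i.
  by rewrite big_distrr; apply: eq_bigr => i _; rewrite /= mE mulnA.
by rewrite -modnMmr c1 modnMmr muln1.
Qed.

(** * The inequality *)

Lemma pA_submul_strict a b : 0 < L -> gcd_upto A L.+1 = 1 ->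
    (3 * L).+1 * D <= a -> (3 * L).+1 * D <= b ->
  pA A (a + b) L.+1 < pA A a L.+1 * pA A b L.+1.
Proof.
move=> L_gt0 gcd1 le_a le_b.
have le_k n : (3 * L).+1 * D <= n -> L.+1 * D <= n.
  by apply: leq_trans; rewrite leq_pmul2r //; lia.
have lt_x : 3 * L < a %/ D by rewrite leq_divRL.
have lt_y : 3 * L < b %/ D by rewrite leq_divRL.
set x := a %/ D in lt_x *; set y := b %/ D in lt_y *.
have le_xy : (a + b) %/ D <= (x + y).+1.
  by rewrite divnD // -addn1 leq_add2l leq_b1.
have lt_bin : 'C(x + y + L.+1, L) < 'C(x, L) * 'C(y, L).
  rewrite (ltn_leqif (leq_bin2l_mul lt_x lt_y _ _)) ?lt0n_neq0 //; lia.
have r_b := residues_neq0 b gcd1.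
apply: leq_ltn_trans (pA_le _) _; first by apply: le_k; lia.
apply: leq_trans (leq_mul (pA_ge (le_k _ le_a)) (pA_ge (le_k _ le_b))).
rewrite mulnACA -/x -/y; apply: leq_ltn_trans
  (_ : #|residues a| * 'C(x + y + L.+1, L) < _).
  apply: leq_mul; first exact: leq_card_residues.
  by rewrite leq_bin2l // addnS -addSn leq_add2r.
have residues_gt0 n : 0 < #|residues n| by rewrite card_gt0 residues_neq0.
apply: (@leq_trans (#|residues a| * ('C(x, L) * 'C(y, L)))).
  by rewrite ltn_pmul2l.
by rewrite leq_mul2r leq_pmulr ?orbT.
Qed.

End Residues.

Lemma lcm_upto_gt0 A k : (forall i, 0 < A i) -> 0 < lcm_upto A k.
Proof.
move=> A_gt0; rewrite /lcm_upto; elim/big_ind: _ => // x y x_gt0 y_gt0.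
by rewrite lcmn_gt0 x_gt0.
Qed.

(** The first two factors of the product already suffice, as k = L + 1 gives
    2 (1 + Dk) (1 + 2Dk) > 4 D k^2 > k (3L + 1) D. *)
Lemma lt_bo_bound L D n : 0 < L -> 0 < D ->
  (bo_bound L.+1 D < n%:R)%R -> (3 * L).+1 * D <= n.
Proof.
move=> L_gt0 D_gt0; rewrite /bo_bound => lt_n.
set P := \prod_(_ <= _ < _) _ in lt_n.
have le_P : (1 + 1 * D * L.+1) * (1 + 2 * D * L.+1) <= P.
  case: L L_gt0 @P {lt_n} => // L _ P; rewrite /P big_ltn // big_ltn //.
  rewrite mulnA leq_pmulr // prodn_cond_gt0 // => i _; lia.
have lt_P : 2 * P < n * L.+1.
  rewrite -(ltr_nat rat) [ltRHS]natrM -ltr_pdivrMr ?ltr0n //.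
  by apply: le_lt_trans lt_n; rewrite lerDl.
rewrite -(leq_pmul2r (ltn0Sn L)); nia.
Qed.

Theorem theorem5p4 (k : nat) (hk : 2 <= k) (A : nat -> nat)
    (hmono : forall i j : nat, i <= j -> A i <= A j)
    (hpos : forall i : nat, 0 < A i)
    (hgcd : gcd_upto A k = 1)
    (a b : nat)
    (ha : (bo_bound k (lcm_upto A k) < a%:R)%R)
    (hb : (bo_bound k (lcm_upto A k) < b%:R)%R) :
  pA A (a + b) k < pA A a k * pA A b k.
Proof.
case: k hk hgcd ha hb => // L L_gt0 gcd1.
have D_gt0 := lcm_upto_gt0 L.+1 hpos.
have A_dvd (i : 'I_L.+1) : A i %| lcm_upto A L.+1 by apply: biglcmn_sup (dvdnn _).
move=> /(lt_bo_bound L_gt0 D_gt0) le_a /(lt_bo_bound L_gt0 D_gt0) le_b.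
exact: pA_submul_strict D_gt0 A_dvd _ _ L_gt0 gcd1 le_a le_b.
Qed.
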